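(* Let $G$ be a group of order $v$. If an $n$-dimensional $(v,k,\lambda)$ difference set $D\subseteq G^n$ exists, then $n\le v$.
   Context: Groups are written additively but are not necessarily abelian. A $(v,k,\lambda)$ difference set in a group $G$ of order $v$ is a $k$-subset $D\subseteq G$ such that every $g\in G\setminus\{0\}$ can be written as $g=a-b$ with $a,b\in D$ in exactly $\lambda$ ways. An $n$-dimensional $(v,k,\lambda)$ difference set in $G$ is a $k$-subset $D\subseteq G^n$ of $n$-tuples such that for every pair of coordinates $1\le x<y\le n$ the set $\{d_x-d_y\mid d\in D\}$ is a $(v,k,\lambda)$ difference set in $G$.
   Formalization: The hypothesis k ≥ 2 is added, since for k ≤ 1 the claim is false: a single n-tuple is an n-dimensional (v,1,0) difference set for every n, and the empty set is a (v,0,0) one. *)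

(* Defs.v *)
From HB Require Import structures.
From mathcomp Require Import all_boot all_fingroup.
Set Implicit Arguments.
Unset Strict Implicit.
Unset Printing Implicit Defensive.

Local Open Scope group_scope.

(* The group is written multiplicatively: [a * b^-1] is the additive [a - b],
   and [1] is the additive [0].  The group is not assumed to be abelian. *)

Definition difference_set (gT : finGroupType) (v k lambda : nat)
    (D : {set gT}) : Prop :=
  [/\ #|[set: gT]| = v,
      #|D| = k
    & forall g : gT, g != 1 ->
        #|[set ab in setX D D | ab.1 * ab.2^-1 == g]| = lambda].

(* The image set below is required to have exactly [k] elements, so
   [d |-> d x * (d y)^-1] is injective on [D] for every pair [x < y]. *)
Definition dim_difference_set (gT : finGroupType) (n v k lambda : nat)
    (D : {set {ffun 'I_n -> gT}}) : Prop :=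
  [/\ #|[set: gT]| = v,
      #|D| = k
    & forall x y : 'I_n, (x < y)%N ->
        difference_set v k lambda [set d x * (d y)^-1 | d : {ffun 'I_n -> gT} in D]].

(* Main.v *)
(* Fix distinct [d, e] in [D].  Since [z |-> z x * (z y)^-1] is injective on [D],
   [d x * (d y)^-1 != e x * (e y)^-1], that is, [(e x)^-1 * d x != (e y)^-1 * d y].
   So [x |-> (e x)^-1 * d x] embeds the coordinates into [G]. *)
Require Import Defs.
From HB Require Import structures.
From mathcomp Require Import all_boot all_fingroup.
Set Implicit Arguments.
Unset Strict Implicit.
Unset Printing Implicit Defensive.

(** Writing [a] as [c * (c^-1 * a)] turns it into [c * d^-1 * b], and [b] cancels on the right; the
    order of the factors is kept throughout. *)
Lemma eq_left_right_quotient (gT : finGroupType) (a b c d : gT) :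
  (c^-1 * a = d^-1 * b -> a * b^-1 = c * d^-1)%g.
Proof.
by move=> eq_quot; rewrite -(mulKVg c a) eq_quot !mulgA mulgK.
Qed.

(** The image of [D] has [k] elements, as many as [D] itself, so no two tuples collide. *)
Lemma dim_difference_set_inj (gT : finGroupType) (n v k lambda : nat)
    (D : {set {ffun 'I_n -> gT}}) (x y : 'I_n) :
  dim_difference_set v k lambda D -> (x < y)%N ->
  {in D &, injective (fun d : {ffun 'I_n -> gT} => (d x * (d y)^-1)%g)}.
Proof.
case=> _ cardD diffD lt_xy; apply/imset_injP.
by case: (diffD x y lt_xy) => _ -> _; rewrite cardD.
Qed.

(* For k <= 1 the claim fails: a single tuple is an n-dimensional
   (v, 1, 0) difference set for every n (and the empty set a (v, 0, 0) one). *)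
Theorem theorem4p1 (gT : finGroupType) (n v k lambda : nat)
    (ord_G : #|[set: gT]| = v) (k_ge2 : (2 <= k)%N) :
  (exists D : {set {ffun 'I_n -> gT}}, dim_difference_set v k lambda D) ->
  (n <= v)%N.
Proof.
case=> D diffD; have [_ cardD _] := diffD.
have /card_gt1P[d [e [Dd De neq_de]]] : (1 < #|D|)%N by rewrite cardD.
have neq_quot (x y : 'I_n) : (x < y)%N ->
    ((e x)^-1 * d x <> (e y)^-1 * d y)%g.
  move=> lt_xy /eq_left_right_quotient eq_de; case/eqP: neq_de.
  exact: (dim_difference_set_inj diffD lt_xy).
have inj_quot : injective (fun x : 'I_n => ((e x)^-1 * d x)%g).
  move=> x y /= eq_xy; apply/val_inj.
  (* [neq_quot] covers only increasing pairs, so distinct coordinates are first put in order. *)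
  by case: (ltngtP x y) => // /neq_quot; rewrite eq_xy.
by rewrite -ord_G cardsT -[n in (n <= _)%N]card_ord; apply: leq_card inj_quot.
Qed.
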